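(* For all $n\geq 0$, the pairs of statistics $(\mathrm{bdes},\mathrm{des})$ and $(\mathrm{pk},\mathrm{des})$ are jointly equidistributed over $\mathfrak{S}_n(231)$; that is, for all $n,k,j\ge 0$, the number of $\pi\in\mathfrak{S}_n(231)$ with $\mathrm{bdes}(\pi)=k$ and $\mathrm{des}(\pi)=j$ equals the number of $\pi\in\mathfrak{S}_n(231)$ with $\mathrm{pk}(\pi)=k$ and $\mathrm{des}(\pi)=j$.
   Context: $\mathfrak{S}_n$ is the set of permutations $\pi=\pi_1\pi_2\cdots\pi_n$ of $[n]=\{1,\dots,n\}$ in one-line notation ($\mathfrak{S}_0$ consists of the empty permutation). $\mathfrak{S}_n(231)$ is the set of $\pi\in\mathfrak{S}_n$ having no length-three subsequence with the same relative order as $231$. For $\pi\in\mathfrak{S}_n$: $\mathrm{des}(\pi)$ is the number of $k\in[n-1]$ with $\pi_k>\pi_{k+1}$; $\mathrm{bdes}(\pi)$ is the number of $k\in[n-1]$ with $\pi_k>\pi_{k+1}+1$ (big descents); $\mathrm{pk}(\pi)$ is the number of $k\in\{2,3,\dots,n-1\}$ with $\pi_{k-1}<\pi_k>\pi_{k+1}$ (peaks). *)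

(* Defs.v *)
From mathcomp Require Import all_boot all_fingroup.

Set Implicit Arguments.
Unset Strict Implicit.
Unset Printing Implicit Defensive.

(* ['I_n] is {0, ..., n-1}: values are shifted by one so that the entries of
   the word of [p] are 1, ..., n, while positions in it are counted from 0. *)
Definition oneline (n : nat) (p : 'S_n) : seq nat :=
  [seq (p i).+1 | i <- enum 'I_n].

Definition same_order (s t : seq nat) : bool :=
  (size s == size t) &&
  all (fun i => all (fun j => (nth 0 s i < nth 0 s j) == (nth 0 t i < nth 0 t j))
                    (iota 0 (size s)))
      (iota 0 (size s)).

Definition avoids231 (w : seq nat) : bool :=
  ~~ [exists a : 'I_(size w), exists b : 'I_(size w), exists c : 'I_(size w),
        [&& a < b, b < c
          & same_order [:: nth 0 w a; nth 0 w b; nth 0 w c] [:: 2; 3; 1]]].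

Definition Av231 (n : nat) : {set 'S_n} := [set p : 'S_n | avoids231 (oneline p)].

(* All [nth] accesses below are in range: the k-th position from 0 ranges over
   [0, n-2] for (big) descents; for peaks k is the position left of the peak,
   so it ranges over [0, n-3]. *)
Definition des (w : seq nat) : nat :=
  count (fun k => nth 0 w k.+1 < nth 0 w k) (iota 0 (size w).-1).

Definition bdes (w : seq nat) : nat :=
  count (fun k => nth 0 w k.+1 + 1 < nth 0 w k) (iota 0 (size w).-1).

Definition pk (w : seq nat) : nat :=
  count (fun k => (nth 0 w k < nth 0 w k.+1) && (nth 0 w k.+2 < nth 0 w k.+1))
        (iota 0 (size w).-2).

(* Main.v *)
(* A nonempty 231-avoiding word of an interval is [s m r] with [m] its maximum
   and every entry of [s] below every entry of [r]; iterating, 231-avoiders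
   correspond to binary trees read in order.  On trees, (pk, des) satisfies
     pk (Node l r)  = pk l + pk r + [l <> Leaf and r <> Leaf],
     des (Node l r) = des l + des r + [r <> Leaf].
   Making [l] the second of the left subtrees hanging off the right spine of [r]
   (the first if [r] is a leaf) gives a tree whose (bdes, des) is obtained from
   those of [l] and [r] by the same equations.  Using this operation in place of
   [Node] throughout a tree is an injection that carries pk to bdes and
   preserves des. *)

Require Import Defs.
From mathcomp Require Import all_boot all_fingroup.
From mathcomp Require Import zify.

Set Implicit Arguments.
Unset Strict Implicit.
Unset Printing Implicit Defensive.

(** * Binary trees, their words and statistics, and the map [respine] *)

Inductive tree := Leaf | Node of tree & tree.

Definition is_node t := if t is Node _ _ then true else false.

Fixpoint tsize t := if t is Node l r then (tsize l + tsize r).+1 else 0.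

Fixpoint word o t :=
  if t is Node l r then
    word o l ++ (o + tsize l + tsize r) :: word (o + tsize l) r
  else [::].

Fixpoint tdes t :=
  if t is Node l r then tdes l + tdes r + is_node r else 0.

Definition left_node t := if t is Node l _ then is_node l else false.

(** In the word, the root is followed by the first entry of [r]. This descent is big unless that
    entry is the root of [r], which comes first when [r] has no left subtree. *)
Fixpoint tbdes t :=
  if t is Node l r then tbdes l + tbdes r + left_node r else 0.

Fixpoint tpk t :=
  if t is Node l r then tpk l + tpk r + (is_node l && is_node r) else 0.

Definition insert2 x t :=
  if t is Node l r then Node l (Node x r) else Node x Leaf.

Fixpoint respine t :=
  if t is Node l r then insert2 (respine l) (respine r) else Leaf.

(** The right subtree of the result is [Leaf] exactly when [t] is, so the branch taken can be read
    off. *)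
Lemma insert2_inj x t x' t' :
  insert2 x t = insert2 x' t' -> x = x' /\ t = t'.
Proof.
case: t t' => [|l r] [|l' r'] //=; first by case=> ->.
by case=> -> -> ->.
Qed.

Lemma respine_inj : injective respine.
Proof.
elim=> [|l IHl r IHr] [|l' r'] //=.
- by case: (respine r').
- by case: (respine r).
- by case/insert2_inj=> /IHl -> /IHr ->.
Qed.

Lemma is_node_respine t : is_node (respine t) = is_node t.
Proof. by case: t => //= l r; case: (respine r). Qed.

Lemma tsize_respine t : tsize (respine t) = tsize t.
Proof.
elim: t => //= l <- r <-.
by case: (respine r) => [|a b] /=; lia.
Qed.

Lemma tdes_respine t : tdes (respine t) = tdes t.
Proof.
elim: t => //= l <- r <-; rewrite -(is_node_respine r).
by case: (respine r) => [|a b] /=; lia.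
Qed.

(** Along a right spine, [tbdes] counts the nonempty left subtrees other than the first. One
    inserted in second place is therefore counted when nonempty, and the others keep their
    contribution. *)
Lemma tbdes_respine t : tbdes (respine t) = tpk t.
Proof.
elim: t => //= l <- r <-; rewrite -(is_node_respine l) -(is_node_respine r).
case: (respine r) => [|a b] /=; first by rewrite andbF.
by rewrite andbT; lia.
Qed.

Lemma size_word o t : size (word o t) = tsize t.
Proof.
by elim: t o => //= l IHl r IHr o; rewrite size_cat /= IHl IHr addnS.
Qed.

Lemma perm_cat_iotaS o n s r :
  perm_eq (s ++ o + n :: r) (iota o n.+1) = perm_eq (s ++ r) (iota o n).
Proof.
rewrite perm_catC perm_sym -addn1 iotaD cats1 perm_rcons perm_cons.
by rewrite perm_sym perm_catC.
Qed.

Lemma perm_word o t : perm_eq (word o t) (iota o (tsize t)).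
Proof.
elim: t o => //= l IHl r IHr o.
by rewrite -addnA perm_cat_iotaS iotaD perm_cat.
Qed.

Lemma mem_word o t x : (x \in word o t) = (o <= x < o + tsize t).
Proof. by rewrite (perm_mem (perm_word o t)) mem_iota. Qed.

(** * Statistics of a word split at its maximum *)

Lemma desE x y w : des [:: x, y & w] = (y < x) + des (y :: w).
Proof. by rewrite /des /= (iotaDl 1 0) count_map. Qed.

Lemma bdesE x y w : bdes [:: x, y & w] = (y + 1 < x) + bdes (y :: w).
Proof. by rewrite /bdes /= (iotaDl 1 0) count_map. Qed.

Lemma pkE x y z w :
  pk [:: x, y, z & w] = ((x < y) && (z < y)) + pk [:: y, z & w].
Proof. by rewrite /pk /= (iotaDl 1 0) count_map. Qed.

(** No descent goes into the maximum, and one leaves it as soon as an entry follows. *)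
Lemma des_cat_max s m r :
    {in s, forall x, x < m} -> {in r, forall x, x < m} ->
  des (s ++ m :: r) = des s + des r + (r != [::]).
Proof.
move=> sm rm; elim: s sm => [_|x [|y s] IHs sm].
- case: r rm => [|y r] rm //=.
  by rewrite desE rm ?mem_head // addnC.
- rewrite /= desE IHs // ltnNge ltnW //.
  by apply: sm; rewrite mem_head.
- rewrite /= !desE -!addnA; congr (_ + _); rewrite !addnA; apply: IHs => z sz.
  by apply: sm; rewrite inE sz orbT.
Qed.

Lemma bdes_cat_max s m r : {in s, forall x, x < m} ->
  bdes (s ++ m :: r) = bdes s + bdes r + ((r != [::]) && (head 0 r + 1 < m)).
Proof.
elim: s => [_|x [|y s] IHs sm].
- by case: r => [|y r] //=; rewrite bdesE addnC.
- rewrite /= bdesE IHs // ltnNge addn1 ltnW //.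
  by apply/ltnW/sm; rewrite mem_head.
- rewrite /= !bdesE -!addnA; congr (_ + _); rewrite !addnA; apply: IHs => z sz.
  by apply: sm; rewrite inE sz orbT.
Qed.

Lemma pk_cons_max m r : {in r, forall x, x < m} -> pk (m :: r) = pk r.
Proof.
case: r => [|y [|z r]] rm //.
by rewrite pkE ltnNge ltnW // rm ?mem_head.
Qed.

Lemma pk_cat_max s m r :
    {in s, forall x, x < m} -> {in r, forall x, x < m} ->
  pk (s ++ m :: r) = pk s + pk r + ((s != [::]) && (r != [::])).
Proof.
move=> sm rm; elim: s sm => [_|x [|y s] IHs sm].
- by rewrite pk_cons_max ?addn0.
- case: r rm {IHs} => [|y r] rm //.
  rewrite /= pkE pk_cons_max // sm ?mem_head // rm ?mem_head //.
  by rewrite addnC.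
- have ys_m : {in y :: s, forall z, z < m}.
    by move=> z sz; apply: sm; rewrite inE sz orbT.
  move/(_ ys_m) in IHs; case: s sm {ys_m} IHs => [|z s] sm IHs.
    (* Here [s] is [[:: x; y]]: followed by the larger [m], its last entry [y] is no peak. *)
    rewrite /= pkE [pk [:: y, m & r]]IHs.
    have ym : y < m by apply: sm; rewrite !inE eqxx orbT.
    by rewrite (ltnNge m) (ltnW ym) andbF.
  by rewrite /= !pkE IHs /= !addnA.
Qed.

Lemma word_nil o t : (word o t != [::]) = is_node t.
Proof. by rewrite -size_eq0 size_word; case: t. Qed.

Lemma word_left_lt o l r : {in word o l, forall x, x < o + tsize l + r}.
Proof. by move=> x; rewrite mem_word; lia. Qed.

Lemma word_right_lt o r : {in word o r, forall x, x < o + tsize r}.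
Proof. by move=> x; rewrite mem_word => /andP[]. Qed.

Lemma des_word o t : des (word o t) = tdes t.
Proof.
elim: t o => //= l IHl r IHr o.
rewrite des_cat_max ?IHl ?IHr ?word_nil //.
- exact: word_left_lt.
- exact: word_right_lt.
Qed.

Lemma pk_word o t : pk (word o t) = tpk t.
Proof.
elim: t o => //= l IHl r IHr o.
rewrite pk_cat_max ?IHl ?IHr ?word_nil //.
- exact: word_left_lt.
- exact: word_right_lt.
Qed.

(** [o + tsize t] is the entry preceding this word when [t] is a right subtree. The head is one less
    if the left subtree is empty; otherwise it lies in the left subword, below the maximum of
    [t]. *)
Lemma head_word o t :
  is_node t -> (head 0 (word o t) + 1 < o + tsize t) = left_node t.
Proof.
case: t => //= l r _.
case: l => [|a b]; first by rewrite /= addn0; lia.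
move: (Node a b) (isT : is_node (Node a b)) => l; rewrite -(word_nil o) => wl.
have := mem_word o l; rewrite /= wl.
by case: (word o l) wl => // x w _ /(_ x); rewrite mem_head /=; lia.
Qed.

Lemma bdes_word o t : bdes (word o t) = tbdes t.
Proof.
elim: t o => //= l IHl r IHr o.
rewrite bdes_cat_max ?IHl ?IHr ?word_nil //; last exact: word_left_lt.
congr (_ + nat_of_bool _).
by case: r {IHr} => // a b; rewrite head_word.
Qed.

(** * 231-avoidance, and recovering a tree from its word *)

Lemma same_order231 x y z :
  same_order [:: x; y; z] [:: 2; 3; 1] = (z < x) && (x < y).
Proof. by rewrite /same_order /= !ltnn /=; apply/idP/idP; lia. Qed.

Lemma avoids231P w :
  reflect (forall a b c, a < b -> b < c -> c < size w ->
             nth 0 w c < nth 0 w a -> nth 0 w a < nth 0 w b -> False)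
          (avoids231 w).
Proof.
apply: (iffP idP) => [avw a b c ab bc cw ca ab'|avw].
  have bw := ltn_trans bc cw; have aw := ltn_trans ab bw.
  case/negP: avw; apply/existsP; exists (Ordinal aw).
  apply/existsP; exists (Ordinal bw); apply/existsP; exists (Ordinal cw).
  by rewrite same_order231 /= ab bc ca.
apply/negP => /existsP[a /existsP[b /existsP[c]]].
rewrite same_order231 => /and3P[ab bc /andP[ca ab']].
exact: (avw a b c).
Qed.

(** An occurrence of 231 starting in [s] ends below its first entry, hence stays in [s]. None starts
    at [m], as nothing after it is larger; any other lies in [r]. *)
Lemma avoids231_cat_max (s r : seq nat) (m : nat) :
    {in s & m :: r, forall x y, x < y} -> {in r, forall x, x < m} ->
  avoids231 s -> avoids231 r -> avoids231 (s ++ m :: r).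
Proof.
move=> sr rm /avoids231P avs /avoids231P avr; apply/avoids231P => a b c ab bc.
rewrite size_cat /= => cw; have ac := ltn_trans ab bc.
rewrite !nth_cat; case: (ltnP a (size s)) => sa.
- case: (ltnP c (size s)) => sc.
    by rewrite (ltn_trans bc sc); apply: avs.
  by rewrite ltnNge ltnW //; apply: sr; apply: mem_nth => //=; lia.
- rewrite [b < _]ltnNge [c < _]ltnNge.
  rewrite (leq_trans sa (ltnW ab)) (leq_trans sa (ltnW ac)) /=.
  (* As [size s <= a < b < c], positions [b] and [c] lie past [m]; [j] and [k] are their positions
     in [r]. *)
  have [j Eb] : exists j, b - size s = j.+1 by exists (b - size s).-1; lia.
  have [k Ec] : exists k, c - size s = k.+1 by exists (c - size s).-1; lia.
  have [jk kr] : j < k /\ k < size r by lia.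
  rewrite Eb Ec; case Ea: (a - size s) => [|i] /=.
    by move=> _; rewrite ltnNge ltnW // rm // mem_nth // (ltn_trans jk).
  by apply: avr => //; lia.
Qed.

Lemma avoids231_catl s t : avoids231 (s ++ t) -> avoids231 s.
Proof.
move=> /avoids231P av; apply/avoids231P => a b c ab bc cs.
have bs := ltn_trans bc cs; have := av a b c ab bc.
rewrite !nth_cat cs bs (ltn_trans ab bs) size_cat; apply.
exact: ltn_addr.
Qed.

Lemma avoids231_catr s t : avoids231 (s ++ t) -> avoids231 t.
Proof.
move=> /avoids231P av; apply/avoids231P => a b c ab bc ct.
have := av (size s + a) (size s + b) (size s + c).
rewrite !nth_cat ![_ + _ < size s]ltnNge !leq_addr /= !addKn.
by rewrite size_cat !ltn_add2l; apply.
Qed.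

(** If [y < x], then [x], [m], [y] would form a 231. *)
Lemma avoids231_sep s m r : uniq (s ++ r) -> {in s, forall x, x < m} ->
  avoids231 (s ++ m :: r) -> {in s & r, forall x y, x < y}.
Proof.
rewrite cat_uniq => /and3P[_ /hasPn sr _] sm /avoids231P av x y xs yr.
have xy : x != y by apply: contraNneq (sr y yr) => <-.
rewrite ltn_neqAle xy leqNgt; apply/negP => yx.
have ixs : index x s < size s by rewrite index_mem.
apply: (av (index x s) (size s) (size s + (index y r).+1)) => //.
- by rewrite addnS ltnS leq_addr.
- by rewrite size_cat ltn_add2l ltnS index_mem.
- by rewrite !nth_cat ixs [_ + _ < _]ltnNge leq_addr /= addKn /= !nth_index.
- by rewrite !nth_cat ixs ltnn subnn nth_index //= sm.
Qed.

Lemma avoids231_word o t : avoids231 (word o t).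
Proof.
elim: t o => [|l IHl r IHr] o.
  by apply/avoids231P.
apply: avoids231_cat_max => //; last exact: word_right_lt.
by move=> x y; rewrite inE !mem_word; lia.
Qed.

(** Since [s] lies below [r], sorting the two parts separately sorts the whole; the resulting
    interval is then cut at [size s]. *)
Lemma perm_iota_cat o s r :
    perm_eq (s ++ r) (iota o (size s + size r)) ->
    {in s & r, forall x y, x < y} ->
  perm_eq s (iota o (size s)) /\ perm_eq r (iota (o + size s) (size r)).
Proof.
move=> sr lt_sr.
have : sort leq s ++ sort leq r = iota o (size s + size r).
  apply: (sorted_eq leq_trans anti_leq); first last.
  - by apply: perm_trans sr; rewrite perm_cat ?perm_sort.
  - exact: iota_sorted.
  rewrite sorted_pairwise ?pairwise_cat; last exact: leq_trans.
  rewrite -!sorted_pairwise ?sort_sorted //;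
    try exact: leq_trans; try exact: leq_total.
  rewrite !andbT; apply/allrelP => x y; rewrite !mem_sort => xs yr.
  exact: ltnW (lt_sr x y xs yr).
move/eqP; rewrite iotaD eqseq_cat ?size_sort ?size_iota //.
case/andP=> /eqP <- /eqP <-.
by rewrite !(perm_sym _ (sort _ _)) !perm_sort.
Qed.

(** Strong induction on the length: around the maximum, [avoids231_sep] and [perm_iota_cat] make
    both sides words of intervals, which come from the two subtrees. *)
Lemma word_surj o n w : perm_eq w (iota o n) -> avoids231 w ->
  exists2 t, tsize t = n & word o t = w.
Proof.
have [m] := ubnP n; elim: m => // m IHm in o n w *.
case: n => [|n] n_m wn avw.
  by exists Leaf => //; apply/esym/nilP; rewrite /nilp (perm_size wn).
have mw : o + n \in w by rewrite (perm_mem wn) mem_iota; lia.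
case/splitPr: w / mw wn avw => s r wn avw.
rewrite perm_cat_iotaS in wn.
have En : n = size s + size r by rewrite -size_cat (perm_size wn) size_iota.
have s_max : {in s, forall x, x < o + n}.
  move=> x xs; have := perm_mem wn x.
  by rewrite mem_cat xs mem_iota => /esym/andP[].
have sr : {in s & r, forall x y, x < y}.
  by apply: avoids231_sep s_max avw; rewrite (perm_uniq wn) iota_uniq.
rewrite {1}En in wn; have [ps pr] := perm_iota_cat wn sr.
have [||l sl <-] := IHm _ _ _ _ ps; first by lia.
  exact: avoids231_catl avw.
have [||t st <-] := IHm _ _ _ _ pr; first by lia.
  by move: avw; rewrite -cat_rcons; apply: avoids231_catr.
by exists (Node l t); rewrite /= ?size_word ?sl ?st ?En ?addnA.
Qed.

(* [k] is fuel; [o] is the least entry, so the maximum is [o + (size w).-1]. *)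
Fixpoint decode k o w :=
  if k is k'.+1 then
    if w is [::] then Leaf else
    let i := index (o + (size w).-1) w in
    Node (decode k' o (take i w)) (decode k' (o + i) (drop i.+1 w))
  else Leaf.

Lemma word_decode k o t : tsize t <= k -> decode k o (word o t) = t.
Proof.
elim: k o t => [|k IHk] o [|l r] //= lr_k.
case E: (_ ++ _) => [|x w]; first by case: (word o l) E.
(* The maximum exceeds every entry of [word o l], so its index is [tsize l], and cutting there
   returns the two subwords. *)
rewrite -E size_cat /= addnS !size_word /= addnA index_cat mem_word.
rewrite ltnNge leq_addr andbF /= eqxx addn0 size_word.
rewrite take_size_cat ?size_word // -cat_rcons.
by rewrite drop_size_cat ?size_rcons ?size_word // !IHk //; lia.
Qed.

(** * Transfer to permutations *)

Lemma perm_iota1P n w :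
  reflect (exists p : 'S_n, w = oneline p) (perm_eq w (iota 1 n)).
Proof.
have -> : iota 1 n = [tuple i.+1 | i < n].
  by rewrite /= map_comp val_enum_ord -(iotaDl 1 0).
by apply: (iffP tuple_permP) => -[p ->]; exists p;
  apply: eq_map => i; rewrite tnth_mktuple.
Qed.

Lemma oneline_inj n : injective (@oneline n).
Proof.
move=> p q /eq_in_map pq; apply/permP => i; apply/val_inj.
by have [] := pq i (mem_enum _ i).
Qed.

Definition tree_of_perm n (p : 'S_n) := decode n 1 (oneline p).

(** The identity is a dummy value, reached only when [tsize t] differs from [n]. *)
Definition perm_of_tree n t : 'S_n :=
  odflt 1%g [pick p : 'S_n | oneline p == word 1 t].

Lemma oneline_perm_of_tree n t :
  tsize t = n -> oneline (perm_of_tree n t) = word 1 t.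
Proof.
move=> tn; rewrite /perm_of_tree; case: pickP => [p /eqP //|no_p].
have /perm_iota1P[p Ep] : perm_eq (word 1 t) (iota 1 n).
  by rewrite -tn perm_word.
by have /eqP[] := no_p p.
Qed.

Lemma tree_of_permP n (p : 'S_n) : p \in Av231 n ->
  tsize (tree_of_perm p) = n /\ word 1 (tree_of_perm p) = oneline p.
Proof.
have p1n : perm_eq (oneline p) (iota 1 n) by apply/perm_iota1P; exists p.
rewrite inE => /(word_surj p1n)[t tn tp].
by rewrite /tree_of_perm -tp word_decode ?tn.
Qed.

Definition respine_perm n (p : 'S_n) :=
  perm_of_tree n (respine (tree_of_perm p)).

Lemma oneline_respine_perm n (p : 'S_n) : p \in Av231 n ->
  oneline (respine_perm p) = word 1 (respine (tree_of_perm p)).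
Proof.
by case/tree_of_permP=> pn _; rewrite oneline_perm_of_tree ?tsize_respine.
Qed.

Lemma respine_perm_inj n : {in Av231 n &, injective (@respine_perm n)}.
Proof.
move=> p q pA qA /(congr1 (@oneline n)); rewrite !oneline_respine_perm //.
have [[pn Ep] [qn Eq]] := (tree_of_permP pA, tree_of_permP qA).
move/(congr1 (decode n 1)); rewrite !word_decode ?tsize_respine ?pn ?qn //.
by move/respine_inj=> pq; apply: oneline_inj; rewrite -Ep -Eq pq.
Qed.

(** An injective map of a finite set into itself is onto, so surjectivity follows by counting. *)
Lemma imset_respine_perm n : @respine_perm n @: Av231 n = Av231 n.
Proof.
apply/eqP; rewrite eqEcard card_in_imset ?leqnn ?andbT; last first.
  exact: respine_perm_inj.
apply/subsetP => _ /imsetP[p pA ->].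
by rewrite inE oneline_respine_perm // avoids231_word.
Qed.

Lemma bdes_respine_perm n (p : 'S_n) :
  p \in Av231 n -> bdes (oneline (respine_perm p)) = pk (oneline p).
Proof.
move=> pA; have [_ <-] := tree_of_permP pA.
by rewrite oneline_respine_perm // bdes_word pk_word tbdes_respine.
Qed.

Lemma des_respine_perm n (p : 'S_n) :
  p \in Av231 n -> des (oneline (respine_perm p)) = des (oneline p).
Proof.
move=> pA; have [_ <-] := tree_of_permP pA.
by rewrite oneline_respine_perm // !des_word tdes_respine.
Qed.

Theorem theorem2p3 (n k j : nat) :
  #|[set p in Av231 n | (bdes (oneline p) == k) && (des (oneline p) == j)]| =
  #|[set p in Av231 n | (pk (oneline p) == k) && (des (oneline p) == j)]|.
Proof.
(* By injectivity the [pk] side may be replaced by its image, which is then shown to be the [bdes]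
   set. *)
rewrite -[RHS](card_in_imset (f := @respine_perm n)); last first.
  by move=> p q /setIdP[pA _] /setIdP[qA _]; apply: respine_perm_inj.
apply: eq_card => q; apply/setIdP/imsetP => [[]|[p /setIdP[pA pkj] ->]].
  rewrite -{1}imset_respine_perm => /imsetP[p pA ->] stats; exists p => //.
  by rewrite inE pA -bdes_respine_perm // -des_respine_perm.
split; last by rewrite bdes_respine_perm // des_respine_perm.
by rewrite -imset_respine_perm imset_f.
Qed.
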